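(* Let $a,b\in R^{WD}$, let $a^{WD}$, $b^{WD}$ be WD inverses of $a$ and $b$ respectively, and let $k=\max\{\mathrm{ind}(a),\mathrm{ind}(b)\}$. If $a^{WD}(a+b)b^{WD}=a^{WD}+b^{WD}$, then $aa^{WD}bb^{WD}=aa^{WD}$, $a^{WD}ab^{WD}b=b^{WD}b$, $a^kbb^{WD}=a^k$ and $a^{WD}ab^k=b^k$.
   Context: $R$ is a proper unital ring with involution: an associative ring with $1$ and a map $*:R\to R$ with $(a+b)^*=a^*+b^*$, $(ab)^*=b^*a^*$, $(a^* )^*=a$, such that $a^*a=0$ implies $a=0$. Weak Drazin (WD) inverse: $a\in R$ is WD invertible if there are $x\in R$ and a positive integer $k$ with $axa=a$, $a^{k+1}x=a^k$, $xa^{k+1}=a^k$. The least positive integer $k$ for which such an $x$ exists is the weak Drazin index $\mathrm{ind}(a)$; any $x$ satisfying the three equations with $k=\mathrm{ind}(a)$ is a WD inverse of $a$ (not unique in general), denoted $a^{WD}$. $R^{WD}$ is the set of WD invertible elements. *)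

(* Defs.v *)
From HB Require Import structures.
From mathcomp Require Import all_boot all_order all_algebra.
From mathcomp Require Import boolp.
Set Implicit Arguments.
Unset Strict Implicit.
Unset Printing Implicit Defensive.
Import GRing.Theory.
Local Open Scope ring_scope.

Record proper_involution (R : pzRingType) (star : R -> R) : Prop :=
  ProperInvolution {
    starD : forall a b, star (a + b) = star a + star b;
    starM : forall a b, star (a * b) = star b * star a;
    starK : forall a, star (star a) = a;
    star_proper : forall a, star a * a = 0 -> a = 0
  }.

Definition wd_eqs (R : pzRingType) (a x : R) (k : nat) : Prop :=
  [/\ a * x * a = a, a ^+ k.+1 * x = a ^+ k & x * a ^+ k.+1 = a ^+ k].

Definition wd_exponent (R : pzRingType) (a : R) (k : nat) : Prop :=
  (0 < k)%N /\ exists x : R, wd_eqs a x k.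

Definition wd_invertible (R : pzRingType) (a : R) : Prop :=
  exists k : nat, wd_exponent a k.

Lemma wd_exponent_asbool (R : pzRingType) (a : R) :
  wd_invertible a -> exists k : nat, `[< wd_exponent a k >].
Proof. by move=> [k ak]; exists k; apply/asboolP. Qed.

Definition wd_ind (R : pzRingType) (a : R) (ha : wd_invertible a) : nat :=
  ex_minn (wd_exponent_asbool ha).

Definition is_wd_inverse (R : pzRingType) (a : R) (ha : wd_invertible a)
    (x : R) : Prop :=
  wd_eqs a x (wd_ind ha).

(* Main.v *)
Require Import Defs.
From HB Require Import structures.
From mathcomp Require Import all_boot all_order all_algebra.
Set Implicit Arguments.
Unset Strict Implicit.
Unset Printing Implicit Defensive.
Import GRing.Theory.
Local Open Scope ring_scope.

(** Multiplying the hypothesis by [a] on the left turns [a * aWD * a] into [a], so [a * bWD] cancels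
    from both sides; multiplying by [b] on the right similarly cancels [aWD * b]. The two identities
    that remain pass to powers because [a * aWD] is absorbed on the right by a high power of [a],
    and [bWD * b] on the left by a high power of [b]. *)

Theorem theorem3p7 (R : pzRingType) (star : R -> R)
    (hstar : proper_involution star) (a b : R)
    (ha : wd_invertible a) (hb : wd_invertible b)
    (aWD bWD : R) (haWD : is_wd_inverse ha aWD) (hbWD : is_wd_inverse hb bWD)
    (k : nat) (hk : k = maxn (wd_ind ha) (wd_ind hb)) :
  aWD * (a + b) * bWD = aWD + bWD ->
  [/\ a * aWD * b * bWD = a * aWD,
      aWD * a * bWD * b = bWD * b,
      a ^+ k * b * bWD = a ^+ k
    & aWD * a * b ^+ k = b ^+ k].
Proof.
case: haWD hbWD => [axa axm _] [byb _ ybn] H.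
have E1 : a * aWD * b * bWD = a * aWD.
  move: (congr1 (fun z => a * z) H).
  by rewrite mulrDr mulrDl !mulrDr !mulrA axa addrC => /addIr.
have E2 : aWD * a * bWD * b = bWD * b.
  move: (congr1 (fun z => z * b) H).
  rewrite mulrDr !mulrDl -(mulrA (aWD * b) bWD b) -(mulrA aWD b (bWD * b)).
  by rewrite (mulrA b bWD b) byb addrC => /addrI.
have E3 : a ^+ wd_ind ha * b * bWD = a ^+ wd_ind ha.
  (* With [m = wd_ind ha], [a ^+ m] equals [a ^+ m * (a * aWD)], and [E1] lets the last factor
     absorb [b * bWD]. *)
  by rewrite -axm exprSr -!(mulrA (a ^+ _)) E1.
have E4 : aWD * a * b ^+ wd_ind hb = b ^+ wd_ind hb.
  by rewrite -ybn exprS !mulrA E2.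
split=> //.
- have lek : (wd_ind ha <= k)%N by rewrite hk leq_maxl.
  (* The surplus power of [a] is split off on the left, away from [b * bWD]; for [b] it goes on the
     right. *)
  by rewrite -(subnK lek) exprD -!mulrA (mulrA _ b) E3.
- have lek : (wd_ind hb <= k)%N by rewrite hk leq_maxr.
  by rewrite -(subnKC lek) exprD mulrA E4.
Qed.
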